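(* Let $(\mu_n),(\alpha_n),(\beta_n),(\gamma_n)$ be sequences of positive real numbers with $\alpha_n>0$ for all $n$, satisfying $\mu_{n+1}\leq\mu_n-\alpha_n\beta_n+\gamma_n$ for all $n\in\mathbb{N}$, and suppose that (i) $c>0$ satisfies $\mu_n\leq c$ for all $n$; (ii) $\alpha>0$ satisfies $\alpha_n\leq\alpha$ for all $n$; (iii) $\sum_{i=0}^\infty\alpha_i=\infty$ with rate of divergence $r$. Fix $\varepsilon>0$ and $g:\mathbb{N}\to\mathbb{N}$, and define $h:\mathbb{Q}_+\times\mathbb{N}\to\mathbb{N}$ by $$h(\delta,m):=\tilde g\left(r\left(m,\frac{2c}{\delta}\right)\right),\qquad \tilde g(i):=\max\{j+g(j)\mid j\leq i\}.$$ Suppose $p\in\mathbb{N}$ and $\delta>0$ are such that there exists $m\leq p$ with $$\frac{\gamma_n}{\alpha_n}\leq\min\left\{\frac{\delta}{2},\frac{\varepsilon}{2\alpha}\right\}\quad\text{for all } n\in[m,h(\delta,m)],$$ and $$\beta_n\leq\delta\implies\mu_n\leq\frac{\varepsilon}{2}\quad\text{for all } n\leq h(\delta,p).$$ Then there exists $N\leq r(p,2c/\delta)$ such that $\mu_n\leq\varepsilon$ for all $n\in[N,N+g(N)]$.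
   Context: $\mathbb{Q}_+$ denotes the strictly positive rationals and $[a,a+b]:=\{a,a+1,\dots,a+b\}$. For nonnegative reals $(b_n)$ with $\sum_{i=0}^\infty b_i=\infty$, a rate of divergence is a function $r:\mathbb{N}\times\mathbb{Q}_+\to\mathbb{N}$ with $\sum_{i=n}^{r(n,x)}b_i\geq x$ for all $n\in\mathbb{N}$, $x\in\mathbb{Q}_+$, which is monotone in its first argument ($m\leq n\Rightarrow r(m,x)\leq r(n,x)$). *)

(* Defs.v *)
From HB Require Import structures.
From mathcomp Require Import all_boot all_order all_algebra.
From mathcomp Require Import all_classical all_reals all_analysis.

Set Implicit Arguments.
Unset Strict Implicit.
Unset Printing Implicit Defensive.

Import Order.TTheory GRing.Theory Num.Theory.
Local Open Scope ring_scope.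

(* A function on N x Q_+ is encoded as a total function on nat x rat; only its
   values at strictly positive rationals are ever constrained or used. Since
   0 < x, the first clause forces n <= r n x (an empty sum is 0). *)
Definition rate_of_divergence (R : realType) (b : nat -> R)
    (r : nat -> rat -> nat) : Prop :=
  (forall (n : nat) (x : rat), 0 < x ->
     ratr x <= \sum_(n <= i < (r n x).+1) b i) /\
  (forall (x : rat) (m n : nat), 0 < x -> (m <= n)%N -> (r m x <= r n x)%N).

Definition gtilde (g : nat -> nat) (i : nat) : nat :=
  \max_(j < i.+1) (j + g j)%N.

Definition hfun (r : nat -> rat -> nat) (g : nat -> nat) (c delta : rat)
    (m : nat) : nat :=
  gtilde g (r m (2 * c / delta)).

(* Main.v *)
(* If beta stayed above delta on all of [m, r(m, 2c/delta)], each step would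
   lower mu by more than alpha_i delta / 2, hence by more than c in total,
   contradicting 0 <= mu <= c. So beta_N <= delta, and thus mu_N <= eps/2, for
   some N in that range. From there on mu stays below eps: where
   beta_n <= delta, mu_n is at most eps/2 and a single step adds at most
   gamma_n <= eps/2; where beta_n > delta, mu does not increase. *)

Require Import Defs.
From HB Require Import structures.
From mathcomp Require Import all_boot all_order all_algebra.
From mathcomp Require Import all_classical all_reals all_analysis.
From mathcomp Require Import ring lra.

Import Order.TTheory GRing.Theory Num.Theory.
Local Open Scope ring_scope.

Lemma gtilde_ge (g : nat -> nat) (i j : nat) :
  (j <= i)%N -> (j + g j <= gtilde g i)%N.
Proof.
rewrite -ltnS => ltji.
exact: (leq_bigmax (F := fun k : 'I_i.+1 => (k + g k)%N) (Ordinal ltji)).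
Qed.

Lemma gtilde_mono (g : nat -> nat) (i j : nat) :
  (i <= j)%N -> (gtilde g i <= gtilde g j)%N.
Proof.
move=> leij; apply/bigmax_leqP => k _; apply: gtilde_ge.
by rewrite (leq_trans _ leij) // -ltnS.
Qed.

Lemma exists_small_beta (R : realFieldType) (mu alpha beta gamma : nat -> R)
    (c d : R) (m n : nat) :
  (forall i, 0 <= mu i) -> (forall i, mu i <= c) ->
  (forall i, 0 < alpha i) ->
  (forall i, mu i.+1 <= mu i - alpha i * beta i + gamma i) ->
  0 < d -> (m <= n)%N ->
  (forall i, (m <= i <= n)%N -> gamma i <= d / 2 * alpha i) ->
  2 * c / d <= \sum_(m <= i < n.+1) alpha i ->
  exists2 i, (m <= i <= n)%N & beta i <= d.
Proof.
move=> mu_ge0 mu_le alpha_gt0 mu_rec d_gt0 lemn gamma_le sum_ge.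
(* Searching the finite list of indices either yields the witness or gives [d < beta i] on the whole
   range. *)
have [/hasP[i]|/hasPn beta_gt] :=
    boolP (has (fun i => beta i <= d) (index_iota m n.+1)).
  by rewrite mem_index_iota ltnS; exists i.
(* Of the decrease [alpha i * d], [gamma i] can undo at most half. *)
have drop i : (m <= i < n.+1)%N -> d / 2 * alpha i < mu i - mu i.+1.
  move=> lein; have := beta_gt i; rewrite mem_index_iota => /(_ lein).
  rewrite -ltNge => ltd.
  have := gamma_le i lein; have := mu_rec i.
  have : alpha i * d < alpha i * beta i by rewrite ltr_pM2l.
  lra.
have := ltr_sum_nat (n := n.+1) lemn drop; rewrite -mulr_sumr.
rewrite [ltRHS](telescope_sumr_eq (fun i => - mu i)); last 2 first.
- exact: leqW.
- by move=> i _; rewrite opprK addrC.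
(* The constant [2 * c / d] is chosen so that, at rate [d / 2], the total drop exceeds [c];
   telescoping makes that drop [mu m - mu n.+1], which is at most [c]. *)
have : d / 2 * (2 * c / d) <= d / 2 * \sum_(m <= i < n.+1) alpha i.
  by rewrite ler_pM2l // divr_gt0.
have -> : d / 2 * (2 * c / d) = c by field; rewrite gt_eqF.
have := mu_ge0 n.+1; have := mu_le m; lra.
Qed.

Theorem theorem3p17 (R : realType) (mu alpha beta gamma : nat -> R)
    (mu_ge0 : forall n : nat, 0 <= mu n)
    (alpha_gt0 : forall n : nat, 0 < alpha n)
    (beta_ge0 : forall n : nat, 0 <= beta n)
    (gamma_ge0 : forall n : nat, 0 <= gamma n)
    (mu_rec : forall n : nat, mu n.+1 <= mu n - alpha n * beta n + gamma n)
    (c : rat) (c_gt0 : 0 < c) (mu_le : forall n : nat, mu n <= ratr c)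
    (a : R) (a_gt0 : 0 < a) (alpha_le : forall n : nat, alpha n <= a)
    (alpha_div : (\sum_(0 <= i <oo) (alpha i)%:E)%E = +oo%E)
    (r : nat -> rat -> nat) (r_rate : rate_of_divergence alpha r)
    (eps : R) (eps_gt0 : 0 < eps) (g : nat -> nat)
    (p : nat) (delta : rat) (delta_gt0 : 0 < delta)
    (gamma_small : exists m : nat, (m <= p)%N /\
       forall n : nat, (m <= n <= hfun r g c delta m)%N ->
         gamma n / alpha n <= Num.min (ratr delta / 2) (eps / (2 * a)))
    (beta_mu : forall n : nat, (n <= hfun r g c delta p)%N ->
       beta n <= ratr delta -> mu n <= eps / 2) :
  exists N : nat, (N <= r p (2 * c / delta))%N /\
    forall n : nat, (N <= n <= N + g N)%N -> mu n <= eps.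
Proof.
case: r_rate => r_ge r_mono; case: gamma_small => m [lemp gamma_le].
set x := 2 * c / delta in r_ge r_mono gamma_le *.
have x_gt0 : 0 < x by rewrite divr_gt0 ?mulr_gt0.
have d_gt0 : 0 < ratr delta :> R by rewrite ltr0q.
have ler := r_mono x m p x_gt0 lemp.
(* The first bound is used where [beta] is large, the second where it is small; the latter follows
   from [alpha n <= a]. *)
have gamma_le_min n : (m <= n <= hfun r g c delta m)%N ->
    gamma n <= ratr delta / 2 * alpha n /\ gamma n <= eps / 2.
  move=> /gamma_le; rewrite le_min => /andP[].
  rewrite !ler_pdivrMr // => gd ge; split=> //; apply: (le_trans ge).
  have -> : eps / 2 = eps / (2 * a) * a by field; rewrite gt_eqF.
  by rewrite ler_wpM2l // divr_ge0 ?mulr_ge0 // ltW.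
have lemr : (m <= r m x)%N.
  have := r_ge m x x_gt0; case: (leqP m (r m x)) => // ltrm.
  by rewrite big_geq // lerq0 leNgt x_gt0.
have ler_h : (r m x <= hfun r g c delta m)%N.
  exact: leq_trans (leq_addr _ _) (gtilde_ge g _ _ (leqnn _)).
have [||N /andP[lemN leNr] betaN] := exists_small_beta _ mu alpha beta gamma
    (ratr c) (ratr delta) m (r m x) mu_ge0 mu_le alpha_gt0 mu_rec d_gt0 lemr.
- move=> i /andP[lemi leir].
  by apply: (gamma_le_min i _).1; rewrite lemi (leq_trans leir).
- have <- : ratr x = 2 * ratr c / ratr delta :> R.
    by rewrite /x fmorph_div rmorphM /= ratr_nat.
  exact: r_ge.
(* The search started at the unknown [m]; monotonicity of [r] in its first argument gives a bound in
   terms of [p] alone. *)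
exists N; split; first exact: leq_trans leNr ler.
(* Since [N <= r m x], the whole window stays where [gamma] is controlled, and by monotonicity of
   [gtilde] also where [beta_mu] applies. *)
have leNh : (N + g N <= hfun r g c delta m)%N by exact: gtilde_ge.
have leh : (hfun r g c delta m <= hfun r g c delta p)%N by exact: gtilde_mono.
elim=> [|n IHn] /andP[leNn lenN].
  have leN0 : N = 0%N by apply/eqP; rewrite -leqn0.
  have := beta_mu 0%N isT; rewrite -[X in beta X]leN0 => /(_ betaN); lra.
have lenh : (n.+1 <= hfun r g c delta m)%N := leq_trans lenN leNh.
(* If [n.+1] is [N] itself, the window starts here and [betaN] gives the bound; otherwise the
   induction hypothesis covers [n]. *)
move: leNn; rewrite leq_eqVlt => /predU1P[eqN|].
  have := beta_mu n.+1 (leq_trans lenh leh).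
  by rewrite -eqN => /(_ betaN); lra.
rewrite ltnS => leNn.
have [gd ge] : gamma n <= ratr delta / 2 * alpha n /\ gamma n <= eps / 2.
  by apply: gamma_le_min; rewrite (leq_trans lemN leNn) ltnW.
have mu_n : mu n <= eps by apply: IHn; rewrite leNn ltnW.
have := mu_rec n; have := alpha_gt0 n.
have [led|ltd] := leP (beta n) (ratr delta).
  have := beta_mu n (leq_trans (ltnW lenh) leh) led.
  have := mulr_ge0 (ltW (alpha_gt0 n)) (beta_ge0 n); lra.
(* Here [gamma n] is less than [alpha n * beta n], so [mu n.+1 < mu n]; only this case uses the
   induction hypothesis. *)
have : alpha n * ratr delta < alpha n * beta n by rewrite ltr_pM2l.
have := mulr_gt0 d_gt0 (alpha_gt0 n); lra.
Qed.
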